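(* Let $n\in\mathbb{N}$, $T>0$, and let $u_0,\ldots,u_n:[0,T]\to\mathbb{R}$ be measurable and bounded functions. Define functions $\hat x_k:[0,T]\to\mathbb{R}$, $k\ge 1$, by $\hat x_1(t)=\int_0^t u_0(s)\,ds$ and recursively, for $k\ge 1$, by $$\hat x_{k+1}(t)=\sum_{i=1}^n\binom{n}{i}\sum_{\mathbf{l}\in M(i)}\int_0^t \hat x_{l_1}(s)\cdots\hat x_{l_i}(s)\,u_i(s)\,ds ,$$ where $M(i)=\{(l_1,\ldots,l_i)\in\mathbb{N}^i \mid l_1,\ldots,l_i\ge 1,\ l_1+\cdots+l_i=k\}$, or equivalently by $$\hat x_{k+1}(t)=\sum_{i=1}^n\binom{n}{i}\sum_{\mathbf{l}\in M_{\le}(i)}R(\mathbf{l})\int_0^t \hat x_{l_1}(s)\cdots\hat x_{l_i}(s)\,u_i(s)\,ds ,$$ where $M_{\le}(i)=\{(l_1,\ldots,l_i)\in\mathbb{N}^i \mid 1\le l_1\le l_2\le\cdots\le l_i,\ l_1+\cdots+l_i=k\}$ and $R(\mathbf{l})$ is the number of distinct $i$-tuples obtained by permuting the entries of $\mathbf{l}=(l_1,\ldots,l_i)$. Then $\hat x(t)=\sum_{k=1}^\infty\hat x_k(t)$ is a formal solution of the differential equation $$\dot x(t)=\sum_{i=0}^n\binom{n}{i}u_i(t)\,x^i(t),\qquad x(0)=0 .$$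
   Context: $\mathbb{N}=\{0,1,2,\ldots\}$. The sets $M(i)$ and $M_{\le}(i)$ depend on the current index $k$. The differential equation is understood through the integral equation $x(t)=\int_0^t\sum_{i=0}^n\binom{n}{i}u_i(s)x^i(s)\,ds$. ''Formal solution'' means that no convergence is asserted and the integral equation holds degree by degree, where $\hat x_k$ has degree $k$ and each factor $u_i$ contributes degree $1$. Precisely: with a formal parameter $\varepsilon$ and $X_\varepsilon(t)=\sum_{k\ge1}\varepsilon^k\hat x_k(t)$, one has for all $t\in[0,T]$ the identity of formal power series in $\varepsilon$ (integrals taken coefficientwise) $X_\varepsilon(t)=\int_0^t\sum_{i=0}^n\binom{n}{i}\,\varepsilon\,u_i(s)\,X_\varepsilon(s)^i\,ds$. *)

(* Defs.v *)
From HB Require Import structures.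
From mathcomp Require Import all_boot all_order all_algebra.
From mathcomp Require Import all_classical all_reals all_analysis.
Set Implicit Arguments.
Unset Strict Implicit.
Unset Printing Implicit Defensive.
Import Order.TTheory GRing.Theory Num.Theory.
Import numFieldNormedType.Exports.
Local Open Scope classical_set_scope.
Local Open Scope ring_scope.

(* The real line with its Lebesgue (not merely Borel) sigma-algebra: the domain
   of [completed_lebesgue_measure]. *)
Definition lebesgueTypeR (R : realType) :=
  caratheodory_type ((@wlength R idfun)^*)%mu.

Definition lebesgue_measurable_fun (R : realType) (D : set R) (f : R -> R) :=
  @measurable_fun _ _ (lebesgueTypeR R) R D f.

Definition lebesgue_integrable (R : realType) (D : set R) (f : R -> R) :=
  (@completed_lebesgue_measure R).-integrable D (EFin \o f).

Definition int0 (R : realType) (t : R) (f : R -> R) : R :=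
  \int[@completed_lebesgue_measure R]_(s in `[0, t]) f s.

(* The set M(i) for the index k.  Entries of a tuple of positive integers with
   sum k are at most k, so 'I_k.+1 loses none of them. *)
Definition compositions (k i : nat) : {set i.-tuple 'I_k.+1} :=
  [set l : i.-tuple 'I_k.+1 | [forall j : 'I_i, (0 < tnth l j)%N]
           && (\sum_(j < i) tnth l j == k)%N]%SET.

Definition sorted_compositions (k i : nat) : {set i.-tuple 'I_k.+1} :=
  [set l in compositions k i | sorted leq [seq nat_of_ord a | a <- l]]%SET.

Definition num_rearrangements (k i : nat) (l : i.-tuple 'I_k.+1) : nat :=
  #|[set m : i.-tuple 'I_k.+1 | perm_eq m l]%SET|.

(* In [xh : nat -> R -> R] below, only the entries of index k >= 1 and the values
   at points of [0, T] matter. *)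
Definition rec_compositions (R : realType) (n : nat) (T : R)
    (u : 'I_n.+1 -> R -> R) (xh : nat -> R -> R) : Prop :=
  (forall t : R, 0 <= t <= T -> xh 1%N t = int0 t (u ord0)) /\
  (forall (k : nat) (t : R), (1 <= k)%N -> 0 <= t <= T ->
     xh k.+1 t = \sum_(i < n.+1 | (1 <= i)%N) 'C(n, i)%:R *
       \sum_(l in compositions k i)
         int0 t (fun s => (\prod_(j < i) xh (tnth l j) s) * u i s)).

Definition rec_sorted_compositions (R : realType) (n : nat) (T : R)
    (u : 'I_n.+1 -> R -> R) (xh : nat -> R -> R) : Prop :=
  (forall t : R, 0 <= t <= T -> xh 1%N t = int0 t (u ord0)) /\
  (forall (k : nat) (t : R), (1 <= k)%N -> 0 <= t <= T ->
     xh k.+1 t = \sum_(i < n.+1 | (1 <= i)%N) 'C(n, i)%:R *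
       \sum_(l in sorted_compositions k i) (num_rearrangements l)%:R *
         int0 t (fun s => (\prod_(j < i) xh (tnth l j) s) * u i s)).

(* A formal power series in epsilon is the sequence of its coefficients. *)
Definition fps_one (R : realType) : nat -> R := fun k => (k == 0)%:R.

Definition fps_eps (R : realType) : nat -> R := fun k => (k == 1)%:R.

Definition fps_mul (R : realType) (a b : nat -> R) : nat -> R :=
  fun k => \sum_(j < k.+1) a j * b (k - j)%N.

Definition fps_exp (R : realType) (a : nat -> R) (i : nat) : nat -> R :=
  iter i (fps_mul a) (fps_one R).

(* X_eps(t) = sum_(k >= 1) eps^k xh_k(t) *)
Definition formal_series (R : realType) (xh : nat -> R -> R) (t : R) :
    nat -> R :=
  fun k => if k is 0 then 0 else xh k t.

(* sum_(i <= n) C(n, i) eps u_i(s) X_eps(s)^i *)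
Definition formal_rhs (R : realType) (n : nat) (u : 'I_n.+1 -> R -> R)
    (xh : nat -> R -> R) (s : R) : nat -> R :=
  fun k => \sum_(i < n.+1) 'C(n, i)%:R *
    (u i s * fps_mul (fps_eps R) (fps_exp (formal_series xh s) i) k).

(* The initial condition x(0) = 0 is carried by the integral equation.
   Integrability is required because the integral is a total function. *)
Definition formal_solution (R : realType) (n : nat) (T : R)
    (u : 'I_n.+1 -> R -> R) (xh : nat -> R -> R) : Prop :=
  forall t : R, 0 <= t <= T -> forall k : nat,
    lebesgue_integrable `[0, t] (fun s => formal_rhs u xh s k) /\
    formal_series xh t k = int0 t (fun s => formal_rhs u xh s k).

(* Main.v *)
Require Import Defs.
From HB Require Import structures.
From mathcomp Require Import all_boot all_order all_algebra.
From mathcomp Require Import all_classical all_reals all_analysis.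
From mathcomp Require Import measurable_realfun.
Import Order.TTheory GRing.Theory Num.Theory.
Import numFieldNormedType.Exports.
Local Open Scope classical_set_scope.
Local Open Scope ring_scope.

(** Since [X_eps] has no term of degree [0], the coefficient of [eps^k] in
    [X_eps^i] is the sum, over the compositions of [k] into [i] positive parts,
    of the products of the corresponding [xh] ([fps_exp_compositions]).  The
    factor [eps] shifts degrees by one, so the part of degree [k + 1] of the
    right-hand side of the equation is exactly the integrand of the recursion
    that defines [xh (k + 1)] ([formal_rhsS]).  There is no composition of [0]
    into [i > 0] parts, none of [k > 0] into [0] parts, and one (empty)
    composition of [0] into [0] parts; hence the initial condition on [xh 1]
    and the recursive clause are one formula, [next_term], valid for all
    [k >= 0] and with [i = 0] included ([rec_compositionsE]).

    What remains is to exchange the integral with finite sums and constant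
    factors, which requires the integrands to be integrable.  By strong
    induction on [k], each [xh k] is Lebesgue measurable and bounded on [0, T]:
    this class contains the [u i], is closed under sums and products, and is
    closed under [f |-> (t |-> int_0^t f)] ([bounded_measurable_int0]).

    The two recursions agree because the product of the [xh (l_j)] does not
    depend on the order of the parts: the compositions are grouped according to
    their sorted rearrangement ([sum_sorted_compositions]).  A solution of the
    recursion exists because [xh (k + 1)] is a function of [xh 1, ..., xh k]. *)

Set Implicit Arguments.
Unset Strict Implicit.

(** * Compositions of an integer *)

(** Membership depends only on the list of parts, hence is invariant under
    permutation of the parts. *)
Lemma mem_compositions (k i : nat) (l : i.-tuple 'I_k.+1) :
  (l \in compositions k i) =
  all (fun a : 'I_k.+1 => 0 < a)%N l && (\sum_(a <- l) a == k)%N.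
Proof.
rewrite inE big_tuple; congr (_ && _).
by apply/forallP/all_tnthP.
Qed.

Lemma composition_gt0 (k i : nat) (l : i.-tuple 'I_k.+1) (j : 'I_i) :
  l \in compositions k i -> (0 < tnth l j)%N.
Proof. by rewrite inE => /andP[/forallP]. Qed.

Lemma compositions0 (i : nat) : (0 < i)%N -> compositions 0 i = finset.set0.
Proof.
case: i => // i _; apply/setP => l; rewrite !inE.
apply/negbTE/negP => /andP[/forallP/(_ ord0)].
by rewrite ord1.
Qed.

Lemma compositionsS0 (k : nat) : compositions k.+1 0 = finset.set0.
Proof. by apply/setP => l; rewrite !inE big_ord0 andbF. Qed.

Lemma compositions00 : compositions 0 0 = [set [tuple]]%SET.
Proof.
apply/setP => l; rewrite [l]tuple0 finset.in_set1 eqxx inE big_ord0 andbT.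
by apply/forallP => -[].
Qed.

(** Sorting maps the compositions onto the sorted ones, and the fibre over a
    sorted composition is the set of its rearrangements, on which [F] is
    constant. *)
Lemma sum_sorted_compositions (V : pzRingType) (k i : nat)
    (F : i.-tuple 'I_k.+1 -> V) :
  (forall l m : i.-tuple 'I_k.+1, perm_eq l m -> F l = F m) ->
  \sum_(l in compositions k i) F l =
  \sum_(l in sorted_compositions k i) (num_rearrangements l)%:R * F l.
Proof.
move=> FE; pose r := [rel a b : 'I_k.+1 | (a <= b)%N].
have r_total : total r by move=> a b; exact: leq_total.
have r_trans : transitive r by move=> b a c; exact: leq_trans.
have r_anti : antisymmetric r.
  by move=> a b /= ab; apply/val_inj/anti_leq.
have sortedE (l : i.-tuple 'I_k.+1) :
    (l \in sorted_compositions k i) = (l \in compositions k i) && sorted r l.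
  by rewrite inE sorted_map.
have permC (l m : i.-tuple 'I_k.+1) : perm_eq l m ->
    (l \in compositions k i) = (m \in compositions k i).
  by move=> lm; rewrite !mem_compositions (perm_all _ lm) (perm_big _ lm).
rewrite (partition_big (fun l : i.-tuple _ => [tuple of sort r l])
  (fun l => l \in sorted_compositions k i)) /=; last first.
  move=> l lC; rewrite sortedE /= sort_sorted// andbT.
  by rewrite (permC _ l)// perm_sort.
apply: eq_bigr => m; rewrite sortedE => /andP[mC mr].
have fiberE (l : i.-tuple 'I_k.+1) :
    (l \in compositions k i) && ([tuple of sort r l] == m) = perm_eq l m.
  apply/andP/idP => [[_ /eqP <-]|lm]; first by rewrite perm_sym perm_sort.
  rewrite (permC _ _ lm) mC; split=> //; apply/eqP/val_inj => /=.
  by rewrite -[RHS](sorted_sort r_trans mr); apply/perm_sortP.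
rewrite (eq_bigl _ _ fiberE) (eq_bigr (fun=> F m)) => [|l /FE//].
rewrite sumr_const mulr_natl; congr (_ *+ _).
by apply: eq_card => l; rewrite inE.
Qed.

Lemma fps_mul_eps (R : realType) (a : nat -> R) (k : nat) :
  fps_mul (fps_eps R) a k = if k is k'.+1 then a k' else 0.
Proof.
rewrite /fps_mul /fps_eps; case: k => [|k].
  by rewrite big_ord1/= mul0r.
rewrite (bigD1 (Ordinal (isT : 1 < k.+2)%N))//= mul1r subn1 big1 ?addr0//.
by move=> j; rewrite -val_eqE/= => /negbTE->; rewrite mul0r.
Qed.

(** The coefficients of degree at most [k] of a product of series only involve
    coefficients of degree at most [k]; truncating to polynomials makes
    distributivity available for powers. *)
Lemma fps_exp_poly (R : realType) (a : nat -> R) (i k j : nat) : (j <= k)%N ->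
  fps_exp a i j = ((\poly_(m < k.+1) a m) ^+ i)`_j.
Proof.
elim: i j => [|i IH] j jk; first by rewrite expr0 coef1.
rewrite exprS coefM; apply: eq_bigr => m _.
have mk : (m <= k)%N by rewrite (leq_trans _ jk)// -ltnS.
by rewrite coef_poly ltnS mk -IH// (leq_trans _ jk)// leq_subr.
Qed.

(** Expanding the [i]-th power of [sum_m a_m X^m] gives one monomial for each
    [i]-tuple of exponents.  The degree selects the tuples of sum [k], and those
    with a zero entry contribute nothing because [a 0 = 0]. *)
Lemma fps_exp_compositions (R : realType) (a : nat -> R) (i k : nat) :
  a 0%N = 0 ->
  fps_exp a i k = \sum_(l in compositions k i) \prod_(j < i) a (tnth l j).
Proof.
move=> a0; rewrite (fps_exp_poly a i (leqnn k)) poly_def.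
rewrite -[i in LHS]card_ord -prodr_const bigA_distr_bigA /=.
rewrite (reindex (@finfun_of_tuple _ _)) /=; last first.
  by exists (@tuple_of_finfun _ _) => f _;
    [exact: finfun_of_tupleK | exact: tuple_of_finfunK].
rewrite coef_sum (bigID (mem (compositions k i))) /= [X in _ + X]big1 ?addr0.
  apply: eq_bigr => l; rewrite inE => /andP[_ /eqP lk].
  under eq_bigr do rewrite ffunE.
  by rewrite scaler_prod -expr_sum lk coefZ coefXn eqxx mulr1.
move=> l; rewrite inE => lC.
under eq_bigr do rewrite ffunE.
rewrite scaler_prod -expr_sum coefZ coefXn.
move: lC; rewrite negb_and => /orP[/forallPn[j]|]; last first.
  by rewrite eq_sym => /negbTE->; rewrite mulr0.
by rewrite -eqn0Ngt => /eqP lj; rewrite (bigD1 j)//= lj a0 !mul0r.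
Qed.

(** * Bounded Lebesgue measurable functions *)

(** The bound is an explicit [M] rather than a filter statement, so that bounds
    of sums and products can be computed directly; [bounded_measurableP] relates
    the two forms. *)
Definition bounded_measurable (R : realType) (T : R) (f : R -> R) : Prop :=
  lebesgue_measurable_fun `[0, T] f /\
  exists M, forall t, 0 <= t <= T -> `|f t| <= M.

Lemma borel_lebesgue_measurable (R : realType) (A : set R) :
  measurable A -> measurable (A : set (lebesgueTypeR R)).
Proof. exact: sub_caratheodory. Qed.

Lemma lebesgue_measurable_itv (R : realType) (i : interval R) :
  measurable ([set` i] : set (lebesgueTypeR R)).
Proof. by apply: borel_lebesgue_measurable; exact: measurable_itv. Qed.

Lemma measurable_lebesgue_measurable_fun (R : realType) (D : set R)
    (f : R -> R) :
  measurable D -> measurable_fun D f -> lebesgue_measurable_fun D f.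
Proof.
by move=> mD mf _ Y mY; apply: borel_lebesgue_measurable; exact: mf.
Qed.

Lemma completed_lebesgue_measure_itv0 (R : realType) (t : R) : 0 <= t ->
  completed_lebesgue_measure (`[0, t]%classic : set R) = t%:E.
Proof.
move=> t0.
have -> : completed_lebesgue_measure (`[0, t]%classic : set R) =
          lebesgue_measure (`[0, t]%classic : set R) by [].
rewrite lebesgue_measure_itv/= lte_fin oppr0 adde0.
by case: ltP => // t0'; congr EFin; apply/le_anti/andP.
Qed.

Lemma bounded_measurable_integrable (R : realType) (T t : R) (f : R -> R) :
  0 <= t <= T -> bounded_measurable T f -> lebesgue_integrable `[0, t] f.
Proof.
move=> /andP[t0 tT] [mf [M fM]]; apply: measurable_bounded_integrable.
- exact: lebesgue_measurable_itv.
- by rewrite [ltLHS]completed_lebesgue_measure_itv0// ltry.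
- apply: measurable_funS mf; first exact: lebesgue_measurable_itv.
  by apply: subset_itvl; rewrite bnd_simp.
exists M; split=> [|N MN]; first exact: num_real.
move=> s; rewrite /= in_itv/= => /andP[s0 st].
by rewrite (le_trans _ (ltW MN))// fM// s0 (le_trans st).
Qed.

Lemma bounded_measurable_eq (R : realType) (T : R) (f g : R -> R) :
  (forall t, 0 <= t <= T -> f t = g t) ->
  bounded_measurable T f -> bounded_measurable T g.
Proof.
move=> fg [mf [M fM]]; split; last first.
  by exists M => t tT; rewrite -fg// fM.
apply: eq_measurable_fun mf => t /set_mem /=; rewrite in_itv/=; exact: fg.
Qed.

Lemma bounded_measurable_cst (R : realType) (T c : R) :
  bounded_measurable T (fun=> c).
Proof. by split; [exact: measurable_cst | exists `|c|]. Qed.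

Lemma bounded_measurableD (R : realType) (T : R) (f g : R -> R) :
  bounded_measurable T f -> bounded_measurable T g ->
  bounded_measurable T (fun s => f s + g s).
Proof.
move=> [mf [M fM]] [mg [N gN]]; split; first exact: measurable_funD.
exists (M + N) => t tT; apply: le_trans (ler_normD _ _) _.
by rewrite lerD ?fM ?gN.
Qed.

Lemma bounded_measurableM (R : realType) (T : R) (f g : R -> R) :
  bounded_measurable T f -> bounded_measurable T g ->
  bounded_measurable T (fun s => f s * g s).
Proof.
move=> [mf [M fM]] [mg [N gN]]; split; first exact: measurable_funM.
by exists (M * N) => t tT; rewrite normrM ler_pM ?fM ?gN.
Qed.

Lemma bounded_measurable_sum (R : realType) (T : R) (I : Type) (r : seq I)
    (P : pred I) (F : I -> R -> R) :
  (forall i, P i -> bounded_measurable T (F i)) ->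
  bounded_measurable T (fun s => \sum_(i <- r | P i) F i s).
Proof.
move=> bF; elim: r => [|i r IH].
  under eq_fun do rewrite big_nil.
  exact: bounded_measurable_cst.
under eq_fun do rewrite big_cons; have [Pi|//] := boolP (P i).
exact: bounded_measurableD (bF i Pi) IH.
Qed.

Lemma bounded_measurable_prod (R : realType) (T : R) (I : Type) (r : seq I)
    (P : pred I) (F : I -> R -> R) :
  (forall i, P i -> bounded_measurable T (F i)) ->
  bounded_measurable T (fun s => \prod_(i <- r | P i) F i s).
Proof.
move=> bF; elim: r => [|i r IH].
  under eq_fun do rewrite big_nil.
  exact: bounded_measurable_cst.
under eq_fun do rewrite big_cons; have [Pi|//] := boolP (P i).
exact: bounded_measurableM (bF i Pi) IH.
Qed.

Section int0_theory.
Variables (R : realType) (T : R).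

Lemma int0D (t : R) (f g : R -> R) : 0 <= t <= T ->
  bounded_measurable T f -> bounded_measurable T g ->
  int0 t (fun s => f s + g s) = int0 t f + int0 t g.
Proof.
move=> tT bf bg; apply: RintegralD; first exact: lebesgue_measurable_itv.
- exact: bounded_measurable_integrable bf.
- exact: bounded_measurable_integrable bg.
Qed.

Lemma int0Z (t c : R) (f : R -> R) : 0 <= t <= T -> bounded_measurable T f ->
  int0 t (fun s => c * f s) = c * int0 t f.
Proof.
move=> tT bf; apply: RintegralZl; first exact: lebesgue_measurable_itv.
exact: bounded_measurable_integrable bf.
Qed.

Lemma int0_cst (t c : R) : 0 <= t -> int0 t (fun=> c) = c * t.
Proof.
move=> t0; rewrite /int0 Rintegral_cst; last exact: lebesgue_measurable_itv.
by rewrite [X in fine X]completed_lebesgue_measure_itv0.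
Qed.

Lemma int0_sum (t : R) (I : Type) (r : seq I) (P : pred I) (F : I -> R -> R) :
  0 <= t <= T -> (forall i, P i -> bounded_measurable T (F i)) ->
  int0 t (fun s => \sum_(i <- r | P i) F i s) =
  \sum_(i <- r | P i) int0 t (F i).
Proof.
move=> tT bF; have /andP[t0 _] := tT; elim: r => [|i r IH].
  by under eq_fun do rewrite big_nil; rewrite big_nil int0_cst// mul0r.
under eq_fun do rewrite big_cons; rewrite big_cons; have [Pi|//] := boolP (P i).
by rewrite int0D ?IH//; [exact: bF | exact: bounded_measurable_sum].
Qed.

Lemma int0_nondecreasing (f : R -> R) (s t : R) : bounded_measurable T f ->
  (forall r, 0 <= r <= T -> 0 <= f r) -> s <= t <= T -> int0 s f <= int0 t f.
Proof.
move=> bf f0 /andP[st tT].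
(* For [s < 0] the domain of integration is empty. *)
have [s0|s0] := ltP s 0.
  rewrite {1}/int0 set_itv_ge ?Rintegral_set0; last by rewrite bnd_simp -ltNge.
  apply: Rintegral_ge0 => r; rewrite /= in_itv/= => /andP[r0 rt].
  by rewrite f0// r0 (le_trans rt).
have itg r : 0 <= r <= T -> lebesgue_integrable `[0, r] f.
  by move=> rT; exact: bounded_measurable_integrable bf.
have tT' : 0 <= t <= T by rewrite (le_trans s0 st).
have sT' : 0 <= s <= T by rewrite s0 (le_trans st).
apply: fine_le.
- by apply: integrable_fin_num; [exact: lebesgue_measurable_itv|exact: itg].
- by apply: integrable_fin_num; [exact: lebesgue_measurable_itv|exact: itg].
apply: ge0_subset_integral; [exact: lebesgue_measurable_itv..| | |].
- by have [] := integrableP _ _ _ (itg _ tT').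
- move=> r; rewrite /= in_itv/= lee_fin => /andP[r0 rt].
  by rewrite f0// r0 (le_trans rt).
- by apply: subset_itvl; rewrite bnd_simp.
Qed.

(** With [M] a bound for [|f|], the integrand [f + M] is nonnegative, so that its
    integral over [0, t] is nondecreasing in [t], therefore Borel; the integral
    of [f] differs from it by [M t]. *)
Lemma bounded_measurable_int0 (f : R -> R) : bounded_measurable T f ->
  bounded_measurable T (fun t => int0 t f).
Proof.
move=> bf; have [mf [M fM]] := bf.
pose g s := f s + M.
have bg : bounded_measurable T g.
  exact: bounded_measurableD bf (bounded_measurable_cst _ _).
have g0 r : 0 <= r <= T -> 0 <= g r.
  by move=> /fM; rewrite ler_norml /g -lerBlDr sub0r => /andP[].
(* Capping at [T] makes [G] nondecreasing on the whole line. *)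
pose G t := int0 (Num.min t T) g.
have G_nd : nondecreasing_fun G.
  move=> s t st; apply: int0_nondecreasing => //.
  by rewrite le_min !ge_min st lexx !orbT.
have bG : bounded_measurable T G.
  split.
    apply: measurable_lebesgue_measurable_fun; first exact: measurable_itv.
    by apply: nondecreasing_measurable; first exact: measurable_itv.
  exists (G T) => t /andP[t0 tT].
  rewrite ger0_norm; first exact: G_nd.
  apply: Rintegral_ge0 => r; rewrite /= in_itv/= le_min => /and3P[r0 rt rT].
  by rewrite g0// r0.
have bT : bounded_measurable T (fun t => - M * t).
  apply: bounded_measurableM; first exact: bounded_measurable_cst.
  split.
    by apply: measurable_lebesgue_measurable_fun; first exact: measurable_itv.
  by exists T => t /andP[t0 tT]; rewrite ger0_norm.
apply: bounded_measurable_eq (bounded_measurableD bG bT) => t tT.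
have /andP[t0 tT'] := tT.
rewrite /G (min_idPl tT') int0D ?int0_cst// ?mulNr ?addrK//.
exact: bounded_measurable_cst.
Qed.

End int0_theory.

(** * The recursion and the formal solution *)

Section recursion.
Variables (R : realType) (n : nat) (T : R) (u : 'I_n.+1 -> R -> R).

(** Unlike in the recursion for [k >= 1], the index [i = 0] is included: it
    contributes exactly when [k = 0], and then gives the integral of [u 0]. *)
Definition next_term (x : nat -> R -> R) (k : nat) (t : R) : R :=
  \sum_(i < n.+1) 'C(n, i)%:R * \sum_(l in compositions k i)
    int0 t (fun s => (\prod_(j < i) x (tnth l j) s) * u i s).

Lemma next_term0 (x : nat -> R -> R) (t : R) :
  next_term x 0 t = int0 t (u ord0).
Proof.
rewrite /next_term big_ord_recl [X in _ + X]big1 => [|i _]; last first.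
  by rewrite compositions0// finset.big_set0 mulr0.
rewrite bin0 mul1r addr0 compositions00 finset.big_set1.
by congr (int0 t _); apply/funext => s; rewrite big_ord0 mul1r.
Qed.

Lemma next_term_gt0 (x : nat -> R -> R) (k : nat) (t : R) : (0 < k)%N ->
  next_term x k t = \sum_(i < n.+1 | (1 <= i)%N) 'C(n, i)%:R *
    \sum_(l in compositions k i)
      int0 t (fun s => (\prod_(j < i) x (tnth l j) s) * u i s).
Proof.
case: k => // k _; rewrite [LHS](bigID (fun i : 'I_n.+1 => 1 <= i)%N)/=.
rewrite [X in _ + X]big1 ?addr0// => -[[|i] ilt]//= _.
by rewrite compositionsS0 finset.big_set0 mulr0.
Qed.

Lemma rec_compositionsE (x : nat -> R -> R) :
  rec_compositions T u x <->
  forall k t, 0 <= t <= T -> x k.+1 t = next_term x k t.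
Proof.
split=> [[x1 xS] [|k] t tT|xS].
- by rewrite next_term0 x1.
- by rewrite next_term_gt0// xS.
split=> [t tT|k t k0 tT]; first by rewrite xS// next_term0.
by rewrite xS// next_term_gt0.
Qed.

(** The parts of a composition of [k] are at most [k]. *)
Lemma eq_next_term (x y : nat -> R -> R) (k : nat) :
  (forall m, (m <= k)%N -> x m = y m) -> next_term x k = next_term y k.
Proof.
move=> xy; apply/funext => t; apply: eq_bigr => i _; congr (_ * _).
apply: eq_bigr => l _; congr (int0 t _); apply/funext => s; congr (_ * _).
by apply: eq_bigr => j _; rewrite xy// -ltnS.
Qed.

(** [term_table k] holds the correct terms at all indices at most [k].  Carrying
    the whole table turns the course-of-values recursion into a structural
    one. *)
Fixpoint term_table (k : nat) : nat -> R -> R :=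
  if k is k'.+1 then
    fun m => if (m <= k')%N then term_table k' m
             else next_term (term_table k') k'
  else fun _ _ => 0.

Definition recursive_term (k : nat) : R -> R := term_table k k.

Lemma term_tableE (k m : nat) : (m <= k)%N ->
  term_table k m = recursive_term m.
Proof.
elim: k => [|k IH] mk; first by move: mk; rewrite leqn0 => /eqP->.
have [mk'|km] := leqP m k; first by rewrite /= mk' IH.
by have -> : m = k.+1 by apply/anti_leq; rewrite mk.
Qed.

Lemma recursive_termS (k : nat) :
  recursive_term k.+1 = next_term recursive_term k.
Proof.
rewrite /recursive_term/= ltnn; apply: eq_next_term => m; exact: term_tableE.
Qed.

Lemma rec_compositions_exists : exists x, rec_compositions T u x.
Proof.
exists recursive_term; apply/rec_compositionsE => k t _.
by rewrite recursive_termS.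
Qed.

Lemma rec_compositions_sorted (x : nat -> R -> R) :
  rec_compositions T u x <-> rec_sorted_compositions T u x.
Proof.
have E k t : \sum_(i < n.+1 | (1 <= i)%N) 'C(n, i)%:R *
      \sum_(l in compositions k i)
        int0 t (fun s => (\prod_(j < i) x (tnth l j) s) * u i s) =
    \sum_(i < n.+1 | (1 <= i)%N) 'C(n, i)%:R *
      \sum_(l in sorted_compositions k i) (num_rearrangements l)%:R *
        int0 t (fun s => (\prod_(j < i) x (tnth l j) s) * u i s).
  apply: eq_bigr => i _; congr (_ * _); apply: sum_sorted_compositions => l m lm.
  congr (int0 t _); apply/funext => s; congr (_ * _).
  rewrite -(big_tuple _ _ l xpredT (fun a : 'I_k.+1 => x a s)).
  by rewrite (perm_big _ lm) big_tuple.
split=> -[x1 xS]; split=> // k t k0 tT; first by rewrite -E xS.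
by rewrite E xS.
Qed.

Lemma formal_rhs0 (x : nat -> R -> R) (s : R) : formal_rhs u x s 0%N = 0.
Proof. by apply: big1 => i _; rewrite fps_mul_eps !mulr0. Qed.

(** The parts of a composition are positive, so the convention
    [formal_series x s 0 = 0] is never met on the right. *)
Lemma formal_rhsS (x : nat -> R -> R) (s : R) (k : nat) :
  formal_rhs u x s k.+1 = \sum_(i < n.+1) 'C(n, i)%:R *
    \sum_(l in compositions k i) (\prod_(j < i) x (tnth l j) s) * u i s.
Proof.
apply: eq_bigr => i _; rewrite fps_mul_eps fps_exp_compositions// mulr_sumr.
congr (_ * _); apply: eq_bigr => l lC; rewrite mulrC; congr (_ * _).
apply: eq_bigr => j _; rewrite /formal_series.
by case: (nat_of_ord _) (composition_gt0 j lC).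
Qed.

Hypothesis bu : forall i, bounded_measurable T (u i).

Lemma bounded_measurable_term (x : nat -> R -> R) (k : nat) (i : 'I_n.+1)
    (l : i.-tuple 'I_k.+1) :
  (forall m, (1 <= m <= k)%N -> bounded_measurable T (x m)) ->
  l \in compositions k i ->
  bounded_measurable T (fun s => (\prod_(j < i) x (tnth l j) s) * u i s).
Proof.
move=> bx lC; apply: bounded_measurableM => //.
apply: bounded_measurable_prod => j _; apply: bx.
by rewrite (composition_gt0 j lC) -ltnS ltn_ord.
Qed.

Lemma rec_compositions_bounded_measurable (x : nat -> R -> R) (k : nat) :
  rec_compositions T u x -> (1 <= k)%N -> bounded_measurable T (x k).
Proof.
move=> /rec_compositionsE xS; elim/ltn_ind: k => -[//|k] IH _.
apply: (@bounded_measurable_eq _ _ (next_term x k)) => [t tT|].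
  by rewrite xS.
apply: bounded_measurable_sum => i _.
apply: bounded_measurableM; first exact: bounded_measurable_cst.
apply: bounded_measurable_sum => l lC.
apply: bounded_measurable_int0; apply: bounded_measurable_term lC.
by move=> m /andP[m1 mk]; apply: IH.
Qed.

Lemma rec_compositions_formal_solution (x : nat -> R -> R) :
  rec_compositions T u x -> formal_solution T u x.
Proof.
move=> xr t tT [|k].
  have E : (fun s => formal_rhs u x s 0) = (fun=> 0).
    by apply/funext => s; rewrite formal_rhs0.
  have b0 := bounded_measurable_cst T (0 : R).
  rewrite E int0_cst ?mul0r; last by case/andP: tT.
  by split=> //; exact: bounded_measurable_integrable tT b0.
(* Integrability of each term justifies the termwise integration below. *)
have bl (i : 'I_n.+1) (l : i.-tuple 'I_k.+1) : l \in compositions k i ->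
    bounded_measurable T (fun s => (\prod_(j < i) x (tnth l j) s) * u i s).
  apply: bounded_measurable_term => m /andP[m1 _].
  exact: rec_compositions_bounded_measurable.
have bs (i : 'I_n.+1) := bounded_measurable_sum (index_enum _) (@bl i).
have bi (i : 'I_n.+1) :=
  bounded_measurableM (bounded_measurable_cst T 'C(n, i)%:R) (bs i).
have E : (fun s => formal_rhs u x s k.+1) = (fun s => \sum_(i < n.+1)
    'C(n, i)%:R *
    \sum_(l in compositions k i) (\prod_(j < i) x (tnth l j) s) * u i s).
  by apply/funext => s; rewrite formal_rhsS.
rewrite E; split.
  apply: bounded_measurable_integrable tT _.
  by apply: bounded_measurable_sum => i _; exact: bi.
rewrite (int0_sum _ tT) => [|i _]; last exact: bi.
have /rec_compositionsE xS := xr; rewrite /= xS//.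
apply: eq_bigr => i _; rewrite (int0Z _ tT (bs i)); congr (_ * _).
by rewrite (int0_sum _ tT (bl i)).
Qed.

End recursion.

Lemma bounded_measurableP (R : realType) (T : R) (f : R -> R) :
  bounded_measurable T f <->
  lebesgue_measurable_fun `[0, T] f /\ [bounded f t | t in `[0, T]].
Proof.
split=> -[mf] [M fM]; split => //.
  exists M; split=> [|N MN]; first exact: num_real.
  by move=> t; rewrite /= in_itv/= => tT; rewrite (le_trans _ (ltW MN))// fM.
exists (M + 1) => t tT; case: fM => _ /(_ (M + 1)); apply.
  by rewrite ltrDl.
by rewrite /= in_itv.
Qed.

Unset Implicit Arguments.

Theorem theorem1 (R : realType) (n : nat) (T : R) (u : 'I_n.+1 -> R -> R)
    (T_gt0 : 0 < T)
    (u_meas : forall i, lebesgue_measurable_fun `[0, T] (u i))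
    (u_bounded : forall i, [bounded u i t | t in `[0, T]]) :
  (exists xh : nat -> R -> R, rec_compositions T u xh) /\
  (forall xh : nat -> R -> R,
     (rec_compositions T u xh <-> rec_sorted_compositions T u xh) /\
     (rec_compositions T u xh -> formal_solution T u xh)).
Proof.
split; first exact: rec_compositions_exists.
move=> xh; split; first exact: rec_compositions_sorted.
apply: rec_compositions_formal_solution => i.
by apply/bounded_measurableP.
Qed.
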